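(* Let $\overline{D}$ be a finite set of (trait and class) declarations whose right-hand sides are code literals, such that $\overline{D}\vdash D:\mathrm{OK}$ for every $D\in\overline{D}$. Let $E_0,E_1$ be code expressions. If $E_0\xrightarrow[\overline{D}]{}E_1$, then $$\mathit{wrong}(\overline{D},E_0)\;\ge\;\mathit{wrong}(\overline{D},E_1),$$ where $\mathit{wrong}(\overline{D},E)$ is the number of (occurrences of) code literals $L$ such that $E=\mathcal{E}[L]$ for some full context $\mathcal{E}$ and $L$ is not well typed in $\overline{D}$, i.e. not $\overline{D}\vdash L:\mathrm{OK}$.
   Context: **Syntax.** Trait names $t$ (lowercase), class names $C$ (uppercase; $\mathbf{This}$ is a special class name), method names $m$, variables $x$ (including $\mathbf{this}$). A suffix ''?'' marks an optional item, an overline a finite sequence. - Names $ID::=t\mid C$. Meta-declarations $DE::=ID{=}E$. Declarations $D::=ID{=}L$. - Code expressions $E::=L\mid t\mid E\ast E$ ($\ast$ is the sum operator). - Code literals $L::=\{\mathbf{interface}?\ \mathbf{implements}\ \overline{T}\ \overline{M}\}$; $\overline T$ and $\overline M$ are sets (order immaterial). - Types $T::=C\mid T.C$ (paths, fully qualified from the top level). - Members $M::=\mathbf{static}?\ \mathbf{method}\ T\ m(\overline{T\,x})\ e?\ \mid\ C{=}L$. A method is abstract if its body $e?$ is missing; $C{=}L$ is a nested class. - Expressions $e::=x\mid e.m(\overline e)\mid T.m(\overline e)$. - Compilation contexts $\mathcal{E}_c::=[\,]\mid\mathcal{E}_c\ast E\mid L\ast\mathcal{E}_c$. Full contexts $\mathcal{E}::=[\,]\mid\mathcal{E}\ast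 E\mid E\ast\mathcal{E}$. **Lookup.** $\overline{D}(t)=L$ if $t{=}L\in\overline{D}$. $\overline{D}(C)=L[\mathbf{This}:=C]$ if $C{=}L\in\overline{D}$ (with $\overline D(\mathbf{This})=L$ when $\mathbf{This}{=}L$ is an entry), and $\overline{D}(T.C)=L'$ if $C{=}L'$ is a member of $\overline{D}(T)$. In ''$\overline{D},C{=}L$'' the new entry overrides any old entry for $C$. We write $M\in\overline D(T)$ if $M$ is a member of the literal $\overline D(T)$. **Well-formedness (standing assumption on all programs and literals, including the result of a sum; if the result would be ill-formed, the sum is not performed).** A literal is well formed if in each method parameters have distinct names and none is named $\mathbf{this}$; methods in a literal have distinct names; nested classes in a literal have distinct names, none being $\mathbf{This}$; all used variables are in scope; all methods of an interface literal are abstract and non-static. A program $\overline{DE}$ is well formed if top-level names are distinct and different from $\mathbf{This}$, interface implementation is acyclic, and for every literal occurrence $ID{=}\mathcal{E}[L]\in\overline{DE}$, $\mathit{consistentSubtype}(\overline{DE},\mathbf{This}{=}L;\,L)$ holds. Here $\mathit{consistentSubtype}(\overline{DE};\{\mathbf{interface}?\ \mathbf{implements}\ \overline T\ \overline M\})$ means: every $T\in\overline T$ is looked up in $\overline{DE}$ to an interface literal; for each nested class $C{=}L\in\overline M$, $\mathit{consistentSubtype}(\overline{DE};L)$; and whenever $T\in\overline T$ and $\mathbf{method}\ T_0\ m(\overline{T\,x})\in\overline{DE}(T)$, then $\mathbf{method}\ T_0\ m(\overline{T\,x})\ e?\in\overline M$ for some optional body. **Sum of literals.** The name of a member is its method name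 or nested class name, and $\mathrm{dom}(\overline M)$ is the set of names. If $L_1=\{\mathbf{interface}?\ \mathbf{implements}\ \overline{T}_1\ \overline M_1\,\overline M_0\}$ and $L_2=\{\mathbf{interface}?\ \mathbf{implements}\ \overline{T}_2\ \overline M_2\,\overline M_0'\}$ (both interfaces or both not), with $\mathrm{dom}(\overline M_1)$, $\mathrm{dom}(\overline M_2)$ disjoint and $\mathrm{dom}(\overline M_0)=\mathrm{dom}(\overline M_0')$ the set of common names, then $L_1+L_2=\{\mathbf{interface}?\ \mathbf{implements}\ \overline{T}_1,\overline{T}_2\ \ \overline M_1,\overline M_2,(\overline M_0+\overline M_0')\}$, where same-named members are added pairwise: $M+M'=M'+M$; $(C{=}L)+(C{=}L')=(C{=}(L+L'))$; and $\mathbf{static}?\ \mathbf{method}\ T_0\ m(\overline{T\,x})+\mathbf{static}?\ \mathbf{method}\ T_0\ m(\overline{T\,x})\,e?=\mathbf{static}?\ \mathbf{method}\ T_0\ m(\overline{T\,x})\,e?$ (identical headers, at most one body). Otherwise $+$ is undefined. **Reduction of code expressions** $E\xrightarrow[\overline D]{}E'$ is generated by: - (LOOK-UP) $t\xrightarrow[\overline D]{}\overline D(t)$ for $t$ declared in $\overline D$. - (SUM) $L_1\ast L_2\xrightarrow[\overline D]{}L$ if $L=L_1+L_2$. - (CTX-C) if $E\xrightarrow[\overline D]{}E'$ then $\mathcal{E}_c[E]\xrightarrow[\overline D]{}\mathcal{E}_c[E']$. **Typing.** - Subtyping: $\overline D\vdash T\le T$; and $\overline D\vdash T_1\le T_3$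 if $\overline D(T_1)$ lists some $T_2$ in its $\mathbf{implements}$ and $\overline D\vdash T_2\le T_3$. - Expressions, with $\Gamma$ a finite map from variables to types: $\overline D;\Gamma\vdash x:\Gamma(x)$; subsumption (from $e:T_1$ and $T_1\le T_2$ infer $e:T_2$); $\overline D;\Gamma\vdash T_0.m(e_1\ldots e_n):T$ if $\overline D;\Gamma\vdash e_i:T_i$ for $1\le i\le n$ and $\mathbf{static\ method}\ T\ m(T_1x_1\ldots T_nx_n)\,e?\in\overline D(T_0)$; $\overline D;\Gamma\vdash e_0.m(e_1\ldots e_n):T$ if $\overline D;\Gamma\vdash e_i:T_i$ for $0\le i\le n$ and the non-static $\mathbf{method}\ T\ m(T_1x_1\ldots T_nx_n)\,e?\in\overline D(T_0)$. - Members: $T;\overline D\vdash \mathbf{static}?\ \mathbf{method}\ T_0\ m(T_1x_1\ldots T_nx_n)\,e?:\mathrm{OK}$ if either the method is abstract or its body $e$ satisfies $\overline D;\Gamma\vdash e:T_0$, where $\Gamma=x_1{:}T_1,\ldots,x_n{:}T_n$ for a static method and $\Gamma=\mathbf{this}{:}T,x_1{:}T_1,\ldots,x_n{:}T_n$ otherwise. $T;\overline D\vdash C{=}L:\mathrm{OK}$ if $T.C;\overline D\vdash L:\mathrm{OK}$. - Literals: $T;\overline D\vdash L:\mathrm{OK}$ if $T;\overline D\vdash M:\mathrm{OK}$ for all members $M$ of $L$. For a literal occurring in a code expression, $\overline D\vdash L:\mathrm{OK}$ means $\mathbf{This};\,\overline D,\mathbf{This}{=}L\vdash L:\mathrm{OK}$.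 - Declarations: $\overline D\vdash t{=}L:\mathrm{OK}$ if $\mathbf{This};\,\overline D,\mathbf{This}{=}L\vdash L:\mathrm{OK}$. $\overline D\vdash C{=}L_0:\mathrm{OK}$ if, with $L_1=L_0[\mathbf{This}:=C]$, $C;\,\overline D,C{=}L_1\vdash L_1:\mathrm{OK}$ and $\mathit{coherent}(C,L_1)$. **Coherence.** $\mathit{coherent}(T,\{\mathbf{interface}?\ \mathbf{implements}\ \overline T\ \overline M\})$ holds if $\mathit{coherent}(T.C,L')$ for all $C{=}L'\in\overline M$, and either the literal is an interface, or every abstract non-static method $M'\in\overline M$ satisfies $\mathit{state}(\mathit{factory}(T,\overline M),M')$. Here $\mathit{factory}(T,\overline M)$ is the unique abstract static method in $\overline M$, defined only if there is exactly one and its return type is $T$; and $\mathit{state}(\mathbf{static\ method}\ T\ m(T_1x_1\ldots T_nx_n),M')$ holds iff for some $i$, $M'$ is $\mathbf{method}\ T_i\ x_i()$ (getter) or $\mathbf{method}\ T\ \mathtt{with}x_i(T_i\ \mathit{that})$ (wither). *)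

(* Defs.v *)
From Stdlib Require Import String List Permutation Relation_Operators.
From Stdlib Require Import ClassicalEpsilon.
Export ListNotations.

(** * Syntax *)

(** The four kinds of names are kept apart by the constructors that use them,
    not by capitalisation.  Names are concrete strings because coherence builds
    a method name from a variable: the getter of [x] is the method [x], its
    wither the method [with_ x]. *)
Definition variable := string.
Definition method_name := string.
Definition class_name := string.
Definition trait_name := string.

Definition this : variable := "this"%string.
Definition that : variable := "that"%string.
Definition This : class_name := "This"%string.
Definition with_ (x : variable) : method_name := append "with"%string x.

Inductive id : Type :=
| IdTrait (t : trait_name)
| IdClass (C : class_name).

Inductive type : Type :=
| TClass (C : class_name)
| TPath (T : type) (C : class_name).

Inductive expr : Type :=
| EVar (x : variable)
| ECall (e : expr) (m : method_name) (es : list expr)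
| EStaticCall (T : type) (m : method_name) (es : list expr).

Definition params := list (variable * type).

(** [Literal interface Ts Ms]: the lists [Ts] and [Ms] stand for sets; everything
    below is insensitive to their order. *)
Inductive literal : Type :=
| Literal (interface : bool) (Ts : list type) (Ms : list member)
with member : Type :=
| Method (static : bool) (T0 : type) (m : method_name) (ps : params)
    (body : option expr)
| Nested (C : class_name) (L : literal).

Definition implements (L : literal) : list type :=
  match L with Literal _ Ts _ => Ts end.

Definition members (L : literal) : list member :=
  match L with Literal _ _ Ms => Ms end.

Inductive name : Type :=
| MethodName (m : method_name)
| NestedName (C : class_name).

Definition member_name (M : member) : name :=
  match M with
  | Method _ _ m _ _ => MethodName m
  | Nested C _ => NestedName C
  end.

Definition dom (Ms : list member) : list name := map member_name Ms.

Inductive code : Type :=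
| CLit (L : literal)
| CTrait (t : trait_name)
| CSum (E1 E2 : code).

Inductive comp_ctx : Type :=
| CCHole
| CCLeft (X : comp_ctx) (E : code)
| CCRight (L : literal) (X : comp_ctx).

Fixpoint comp_plug (X : comp_ctx) (E : code) : code :=
  match X with
  | CCHole => E
  | CCLeft X E' => CSum (comp_plug X E) E'
  | CCRight L X => CSum (CLit L) (comp_plug X E)
  end.

Inductive full_ctx : Type :=
| FCHole
| FCLeft (X : full_ctx) (E : code)
| FCRight (E : code) (X : full_ctx).

Fixpoint full_plug (X : full_ctx) (E : code) : code :=
  match X with
  | FCHole => E
  | FCLeft X E' => CSum (full_plug X E) E'
  | FCRight E' X => CSum E' (full_plug X E)
  end.

(** * Substitution of [This] by a class name *)

(** Paths are fully qualified, so only the root of a path can denote the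
    special class [This]. *)
Fixpoint subst_type (C : class_name) (T : type) : type :=
  match T with
  | TClass C' => TClass (if String.eqb C' This then C else C')
  | TPath T C' => TPath (subst_type C T) C'
  end.

Fixpoint subst_expr (C : class_name) (e : expr) : expr :=
  match e with
  | EVar x => EVar x
  | ECall e m es => ECall (subst_expr C e) m (map (subst_expr C) es)
  | EStaticCall T m es => EStaticCall (subst_type C T) m (map (subst_expr C) es)
  end.

Fixpoint subst_literal (C : class_name) (L : literal) : literal :=
  match L with
  | Literal b Ts Ms =>
      Literal b (map (subst_type C) Ts) (map (subst_member C) Ms)
  end
with subst_member (C : class_name) (M : member) : member :=
  match M with
  | Method s T0 m ps e =>
      Method s (subst_type C T0) m
        (map (fun p => (fst p, subst_type C (snd p))) ps)
        (option_map (subst_expr C) e)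
  | Nested C' L => Nested C' (subst_literal C L)
  end.

(** * Declarations and lookup *)

(** Lookup returns the first match, so that [(IdClass C, L) :: D] is
    "D, C = L" with its overriding behaviour. *)
Definition declarations := list (id * literal).

Fixpoint lookup_trait (D : declarations) (t : trait_name) : option literal :=
  match D with
  | nil => None
  | (IdTrait t', L) :: D => if String.eqb t t' then Some L else lookup_trait D t
  | (IdClass _, _) :: D => lookup_trait D t
  end.

(** For [C] equal to [This] the substitution is the identity. *)
Fixpoint lookup_class (D : declarations) (C : class_name) : option literal :=
  match D with
  | nil => None
  | (IdClass C', L) :: D =>
      if String.eqb C C' then Some (subst_literal C L) else lookup_class D C
  | (IdTrait _, _) :: D => lookup_class D C
  end.

Fixpoint lookup_nested (Ms : list member) (C : class_name) : option literal :=
  match Ms with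
  | nil => None
  | Nested C' L :: Ms => if String.eqb C C' then Some L else lookup_nested Ms C
  | Method _ _ _ _ _ :: Ms => lookup_nested Ms C
  end.

Fixpoint lookup (D : declarations) (T : type) : option literal :=
  match T with
  | TClass C => lookup_class D C
  | TPath T C =>
      match lookup D T with
      | Some L => lookup_nested (members L) C
      | None => None
      end
  end.

Definition with_This (D : declarations) (L : literal) : declarations :=
  (IdClass This, L) :: D.

(** * Well-formedness *)

Fixpoint used_vars (e : expr) : list variable :=
  match e with
  | EVar x => [x]
  | ECall e _ es => used_vars e ++ flat_map used_vars es
  | EStaticCall _ _ es => flat_map used_vars es
  end.

(** Methods and nested classes have different kinds of names, so [NoDup (dom Ms)]
    is distinctness of the methods and, separately, of the nested classes. *)
Inductive wf_literal : literal -> Prop :=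
| WfLiteral b Ts Ms :
    (forall s T0 m ps e, In (Method s T0 m ps e) Ms ->
       NoDup (map fst ps) /\ ~ In this (map fst ps)) ->
    NoDup (dom Ms) ->
    ~ In (NestedName This) (dom Ms) ->
    (forall s T0 m ps e x, In (Method s T0 m ps (Some e)) Ms ->
       In x (used_vars e) ->
       In x (map fst ps) \/ (s = false /\ x = this)) ->
    (b = true -> forall s T0 m ps e, In (Method s T0 m ps e) Ms ->
       s = false /\ e = None) ->
    (forall C L, In (Nested C L) Ms -> wf_literal L) ->
    wf_literal (Literal b Ts Ms).

Inductive consistent_subtype (D : declarations) : literal -> Prop :=
| ConsistentSubtype b Ts Ms :
    (forall T, In T Ts ->
       exists Ts' Ms', lookup D T = Some (Literal true Ts' Ms')) ->
    (forall C L, In (Nested C L) Ms -> consistent_subtype D L) ->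
    (forall T L T0 m ps, In T Ts -> lookup D T = Some L ->
       In (Method false T0 m ps None) (members L) ->
       exists e, In (Method false T0 m ps e) Ms) ->
    consistent_subtype D (Literal b Ts Ms).

Definition directly_implements (D : declarations) (T1 T2 : type) : Prop :=
  exists L, lookup D T1 = Some L /\ In T2 (implements L).

Definition acyclic (D : declarations) : Prop :=
  forall T, ~ clos_trans type (directly_implements D) T T.

(** A literal occurring in a code expression, seen from the declarations [D]:
    its own interfaces are reachable through [This], hence acyclicity is
    required of [D, This = L]. *)
Definition wf_occurrence (D : declarations) (L : literal) : Prop :=
  wf_literal L /\
  acyclic (with_This D L) /\
  consistent_subtype (with_This D L) L.

Definition wf_program (D : declarations) : Prop :=
  NoDup (map fst D) /\
  ~ In (IdClass This) (map fst D) /\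
  acyclic D /\
  (forall i L, In (i, L) D -> wf_occurrence D L).

Definition wf_code (D : declarations) (E : code) : Prop :=
  forall X L, E = full_plug X (CLit L) -> wf_occurrence D L.

(** * Sum of literals *)

(** [literal_sum L1 L2 L] is "L1 + L2 = L", up to the order of the members.
    As in the definition of the sum, [N1] and [N2] are the members of one
    summand only, while [N0] and [N0'] are the common ones, here listed in the
    same order and added pairwise.  The two method rules of [member_sum] account
    for the commutativity clause "M + M' = M' + M". *)
Inductive literal_sum : literal -> literal -> literal -> Prop :=
| LiteralSum b Ts1 Ts2 Ts Ms1 Ms2 Ms N1 N2 N0 N0' N :
    Permutation Ms1 (N1 ++ N0) ->
    Permutation Ms2 (N2 ++ N0') ->
    (forall n, In n (dom N1) -> ~ In n (dom N2)) ->
    (forall n, In n (dom N0) <-> In n (dom Ms1) /\ In n (dom Ms2)) ->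
    members_sum N0 N0' N ->
    (forall T, In T Ts <-> In T Ts1 \/ In T Ts2) ->
    Permutation Ms (N1 ++ N2 ++ N) ->
    literal_sum (Literal b Ts1 Ms1) (Literal b Ts2 Ms2) (Literal b Ts Ms)
with member_sum : member -> member -> member -> Prop :=
| MemberSumMethodL s T0 m ps e :
    member_sum (Method s T0 m ps None) (Method s T0 m ps e) (Method s T0 m ps e)
| MemberSumMethodR s T0 m ps e :
    member_sum (Method s T0 m ps e) (Method s T0 m ps None) (Method s T0 m ps e)
| MemberSumNested C L1 L2 L :
    literal_sum L1 L2 L ->
    member_sum (Nested C L1) (Nested C L2) (Nested C L)
with members_sum : list member -> list member -> list member -> Prop :=
| MembersSumNil : members_sum [] [] []
| MembersSumCons M1 M2 M Ms1 Ms2 Ms :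
    member_sum M1 M2 M ->
    members_sum Ms1 Ms2 Ms ->
    members_sum (M1 :: Ms1) (M2 :: Ms2) (M :: Ms).

(** * Reduction of code expressions *)

(** The last premise of [RedSum]: a sum whose result would be ill-formed is not
    performed. *)
Inductive red (D : declarations) : code -> code -> Prop :=
| RedLookup t L :
    lookup_trait D t = Some L ->
    red D (CTrait t) (CLit L)
| RedSum L1 L2 L :
    literal_sum L1 L2 L ->
    wf_occurrence D L ->
    red D (CSum (CLit L1) (CLit L2)) (CLit L)
| RedCtx X E E' :
    red D E E' ->
    red D (comp_plug X E) (comp_plug X E').

(** * Typing *)

Inductive subtype (D : declarations) : type -> type -> Prop :=
| SubRefl T : subtype D T T
| SubStep T1 T2 T3 L :
    lookup D T1 = Some L ->
    In T2 (implements L) ->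
    subtype D T2 T3 ->
    subtype D T1 T3.

Definition environment := list (variable * type).

Fixpoint env_lookup (G : environment) (x : variable) : option type :=
  match G with
  | nil => None
  | (y, T) :: G => if String.eqb x y then Some T else env_lookup G x
  end.

Inductive has_type (D : declarations) (G : environment) : expr -> type -> Prop :=
| TyVar x T :
    env_lookup G x = Some T ->
    has_type D G (EVar x) T
| TySub e T1 T2 :
    has_type D G e T1 ->
    subtype D T1 T2 ->
    has_type D G e T2
| TyStaticCall T0 L T m ps body es :
    lookup D T0 = Some L ->
    In (Method true T m ps body) (members L) ->
    Forall2 (has_type D G) es (map snd ps) ->
    has_type D G (EStaticCall T0 m es) T
| TyCall e0 T0 L T m ps body es :
    has_type D G e0 T0 ->
    lookup D T0 = Some L ->
    In (Method false T m ps body) (members L) ->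
    Forall2 (has_type D G) es (map snd ps) ->
    has_type D G (ECall e0 m es) T.

Definition method_env (static : bool) (T : type) (ps : params) : environment :=
  if static then ps else (this, T) :: ps.

Inductive literal_ok (D : declarations) : type -> literal -> Prop :=
| LiteralOk T b Ts Ms :
    (forall M, In M Ms -> member_ok D T M) ->
    literal_ok D T (Literal b Ts Ms)
with member_ok (D : declarations) : type -> member -> Prop :=
| AbstractOk T s T0 m ps :
    member_ok D T (Method s T0 m ps None)
| ConcreteOk T s T0 m ps e :
    has_type D (method_env s T ps) e T0 ->
    member_ok D T (Method s T0 m ps (Some e))
| NestedOk T C L :
    literal_ok D (TPath T C) L ->
    member_ok D T (Nested C L).

Definition well_typed (D : declarations) (L : literal) : Prop :=
  literal_ok (with_This D L) (TClass This) L.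

(** * Coherence *)

Definition factory (T : type) (Ms : list member) (m : method_name) (ps : params)
  : Prop :=
  In (Method true T m ps None) Ms /\
  (forall T' m' ps', In (Method true T' m' ps' None) Ms ->
     Method true T' m' ps' None = Method true T m ps None).

Definition state (T : type) (ps : params) (M : member) : Prop :=
  exists x Tx, In (x, Tx) ps /\
    (M = Method false Tx x [] None \/
     M = Method false T (with_ x) [(that, Tx)] None).

Inductive coherent : type -> literal -> Prop :=
| Coherent T b Ts Ms :
    (forall C L, In (Nested C L) Ms -> coherent (TPath T C) L) ->
    b = true \/
      (forall T' m' ps', In (Method false T' m' ps' None) Ms ->
         exists m ps, factory T Ms m ps /\
           state T ps (Method false T' m' ps' None)) ->
    coherent T (Literal b Ts Ms).

Definition declaration_ok (D : declarations) (d : id * literal) : Prop :=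
  match d with
  | (IdTrait _, L) => well_typed D L
  | (IdClass C, L0) =>
      let L1 := subst_literal C L0 in
      literal_ok ((IdClass C, L1) :: D) (TClass C) L1 /\ coherent (TClass C) L1
  end.

(** * Counting ill-typed literals *)

(** All decompositions [E = X[L]]; see [occurrences_spec] and
    [occurrences_NoDup]. *)
Fixpoint occurrences (E : code) : list (full_ctx * literal) :=
  match E with
  | CLit L => [(FCHole, L)]
  | CTrait _ => []
  | CSum E1 E2 =>
      map (fun o => (FCLeft (fst o) E2, snd o)) (occurrences E1) ++
      map (fun o => (FCRight E1 (fst o), snd o)) (occurrences E2)
  end.

Lemma occurrences_spec (E : code) (X : full_ctx) (L : literal) :
  In (X, L) (occurrences E) <-> E = full_plug X (CLit L).
Proof.
  revert X; induction E as [L'|t|E1 IH1 E2 IH2]; intros X; simpl.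
  - split.
    + intros [H|[]]; injection H as <- <-; reflexivity.
    + destruct X; simpl; intros H; try discriminate.
      injection H as <-; left; reflexivity.
  - split; [intros []|destruct X; discriminate].
  - rewrite in_app_iff, !in_map_iff; split.
    + intros [[[X' L'] [H HI]]|[[X' L'] [H HI]]]; injection H as <- <-; simpl.
      * apply IH1 in HI; now rewrite <- HI.
      * apply IH2 in HI; now rewrite <- HI.
    + destruct X as [|X E|E X]; simpl; intros H; try discriminate;
        injection H as H1 H2; subst.
      * left; exists (X, L); split; [reflexivity|now apply IH1].
      * right; exists (X, L); split; [reflexivity|now apply IH2].
Qed.

Lemma occurrences_NoDup (E : code) : NoDup (occurrences E).
Proof.
  induction E as [L|t|E1 IH1 E2 IH2]; simpl.
  - repeat constructor; intros [].
  - constructor.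
  - apply NoDup_app.
    + apply NoDup_map_NoDup_ForallPairs; [|exact IH1].
      intros [X L] [X' L'] _ _ H; injection H as -> ->; reflexivity.
    + apply NoDup_map_NoDup_ForallPairs; [|exact IH2].
      intros [X L] [X' L'] _ _ H; injection H as -> ->; reflexivity.
    + intros o; rewrite !in_map_iff.
      intros [[X L] [<- _]] [[X' L'] [H _]]; discriminate H.
Qed.

Definition ill_typed_b (D : declarations) (L : literal) : bool :=
  if excluded_middle_informative (well_typed D L) then false else true.

Definition wrong (D : declarations) (E : code) : nat :=
  length (filter (fun o => ill_typed_b D (snd o)) (occurrences E)).

(* Main.v *)
Require Import Defs.
From Stdlib Require Import String List Permutation ClassicalEpsilon Lia.

(** Everything reduces to the sum step: if [L1] and [L2] are well typed, so is
    [L1 + L2].  A type rooted at [This] denotes in the sum a literal with at least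
    the supertypes and the method headers that it denotes in either summand, and all
    other types keep their meaning.  Typing uses lookup only positively, so every
    method body stays typed when [This] is bound to the sum, and every body of the
    sum comes from one of the summands. *)

Scheme literal_sum_mind := Minimality for literal_sum Sort Prop
  with member_sum_mind := Minimality for member_sum Sort Prop
  with members_sum_mind := Minimality for members_sum Sort Prop.
Combined Scheme sum_mutind
  from literal_sum_mind, member_sum_mind, members_sum_mind.

Scheme literal_ok_mind := Minimality for literal_ok Sort Prop
  with member_ok_mind := Minimality for member_ok Sort Prop.

(** * Substitution of [This] for itself *)

Lemma subst_type_This (T : type) : subst_type This T = T.
Proof.
  induction T as [C|T IH C]; simpl; [|now rewrite IH].
  destruct (String.eqb_spec C This); congruence.
Qed.

Lemma subst_expr_This : forall e, subst_expr This e = e.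
Proof.
  (* Call arguments sit in a list nested inside [expr], so explicit recursion is combined with an
     inner induction on that list. *)
  fix IH 1; intros [x|e m es|T m es]; simpl; [reflexivity| |];
    f_equal; try apply IH; try apply subst_type_This;
    induction es as [|e' es IHes]; simpl; f_equal; auto.
Qed.

(** Since [lookup_class] substitutes into the entry for [This] as well, this is what makes looking
    up [This] return exactly the literal bound to it. *)
Lemma subst_literal_This : forall L, subst_literal This L = L.
Proof.
  fix IH 1; intros [b Ts Ms]; simpl; f_equal.
  - induction Ts; simpl; f_equal; auto using subst_type_This.
  - induction Ms as [|[s T0 m ps e|C L] Ms IHMs]; simpl; f_equal; auto.
    + f_equal; [apply subst_type_This| |].
      * induction ps as [|[x T] ps IHps]; simpl; f_equal; auto.
        now rewrite subst_type_This.
      * destruct e; simpl; f_equal; apply subst_expr_This.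
    + f_equal; apply IH.
Qed.

(** * Extension of literals, and sums as extensions *)

(** Method bodies may differ because a sum can give a body to an abstract method; headers must agree
    since calls are typed by them. Nested classes are compared recursively so that longer paths can
    be followed. *)
Inductive extends : literal -> literal -> Prop :=
| Extends b Ts Ms b' Ts' Ms' :
    incl Ts Ts' ->
    (forall s T0 m ps e, In (Method s T0 m ps e) Ms ->
       exists e', In (Method s T0 m ps e') Ms') ->
    (forall C L, In (Nested C L) Ms ->
       exists L', In (Nested C L') Ms' /\ extends L L') ->
    extends (Literal b Ts Ms) (Literal b' Ts' Ms').

Lemma extends_refl : forall L, extends L L.
Proof.
  fix IH 1; intros [b Ts Ms]; constructor; [apply incl_refl|eauto|].
  induction Ms as [|M Ms IHMs]; intros C L HIn; [destruct HIn|].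
  destruct HIn as [HM|HIn].
  - destruct M as [|C0 L0]; [discriminate HM|]; injection HM as <- <-.
    exists L0; split; [now left|apply IH].
  - destruct (IHMs C L HIn) as [L' [HL' Hext]].
    exists L'; split; [now right|exact Hext].
Qed.

Definition member_extends (M M' : member) : Prop :=
  match M with
  | Method s T0 m ps _ => exists e', M' = Method s T0 m ps e'
  | Nested C L => exists L', M' = Nested C L' /\ extends L L'
  end.

Lemma member_extends_refl (M : member) : member_extends M M.
Proof. destruct M; simpl; eauto using extends_refl. Qed.

Lemma extends_intro (b b' : bool) (Ts Ts' : list type) (Ms Ms' : list member) :
  incl Ts Ts' ->
  (forall M, In M Ms -> exists M', In M' Ms' /\ member_extends M M') ->
  extends (Literal b Ts Ms) (Literal b' Ts' Ms').
Proof.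
  intros HTs HMs; constructor; [exact HTs| |].
  - intros s T0 m ps e HIn; destruct (HMs _ HIn) as [M' [HM' [e' ->]]]; eauto.
  - intros C L HIn; destruct (HMs _ HIn) as [M' [HM' [L' [-> Hext]]]]; eauto.
Qed.

(** Members of one summand only are kept verbatim; common methods have identical headers, and common
    nested classes are summed, which calls for the mutual induction. *)
Lemma sum_extends :
  (forall L1 L2 L, literal_sum L1 L2 L -> extends L1 L /\ extends L2 L) /\
  (forall M1 M2 M, member_sum M1 M2 M ->
     member_extends M1 M /\ member_extends M2 M) /\
  (forall Ms1 Ms2 Ms, members_sum Ms1 Ms2 Ms ->
     (forall M, In M Ms1 -> exists M', In M' Ms /\ member_extends M M') /\
     (forall M, In M Ms2 -> exists M', In M' Ms /\ member_extends M M')).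
Proof.
  apply sum_mutind.
  - intros b Ts1 Ts2 Ts Ms1 Ms2 Ms N1 N2 N0 N0' N H1 H2 _ _ _ [IH1 IH2] HTs HMs.
    assert (HIn : forall M, In M N1 \/ In M N2 \/ In M N -> In M Ms).
    { intros M HM; apply (Permutation_in M (Permutation_sym HMs)).
      rewrite !in_app_iff; exact HM. }
    split; apply extends_intro; try (intros T HT; apply HTs; tauto); intros M HM.
    + apply (Permutation_in M H1), in_app_iff in HM as [HM|HM].
      * exists M; split; [auto|apply member_extends_refl].
      * destruct (IH1 M HM) as [M' [HM' Hext]]; exists M'; auto.
    + apply (Permutation_in M H2), in_app_iff in HM as [HM|HM].
      * exists M; split; [auto|apply member_extends_refl].
      * destruct (IH2 M HM) as [M' [HM' Hext]]; exists M'; auto.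
  - simpl; split; eexists; reflexivity.
  - simpl; split; eexists; reflexivity.
  - intros C L1 L2 L _ [IH1 IH2]; simpl; split; eexists; split; eauto.
  - simpl; tauto.
  - intros M1 M2 M Ms1 Ms2 Ms _ [IH1 IH2] _ [IHs1 IHs2].
    split; intros M' [<-|HM'].
    + exists M; simpl; auto.
    + destruct (IHs1 M' HM') as [M'' []]; exists M''; simpl; auto.
    + exists M; simpl; auto.
    + destruct (IHs2 M' HM') as [M'' []]; exists M''; simpl; auto.
Qed.

(** * Lookup when [This] is rebound to an extension *)

Lemma lookup_nested_In (Ms : list member) (C : class_name) (L : literal) :
  lookup_nested Ms C = Some L -> In (Nested C L) Ms.
Proof.
  induction Ms as [|[s T0 m ps e|C' L'] Ms IH]; simpl; [discriminate|auto|].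
  destruct (String.eqb_spec C C') as [<-|_]; [|auto].
  intros H; injection H as ->; now left.
Qed.

Lemma In_lookup_nested (Ms : list member) (C : class_name) (L : literal) :
  NoDup (dom Ms) -> In (Nested C L) Ms -> lookup_nested Ms C = Some L.
Proof.
  intros Hnd HIn; induction Ms as [|M Ms IH]; [destruct HIn|].
  inversion Hnd as [|n ns Hn Hnd' [Heqn]]; subst.
  destruct HIn as [->|HIn]; simpl; [now rewrite String.eqb_refl|].
  destruct M as [s T0 m ps e|C' L']; [auto|].
  destruct (String.eqb_spec C C') as [<-|_]; [|auto].
  destruct Hn; exact (in_map member_name _ _ HIn).
Qed.

Lemma wf_literal_nested (L L' : literal) (C : class_name) :
  wf_literal L -> In (Nested C L') (members L) -> wf_literal L'.
Proof. intros H; destruct H; simpl; eauto. Qed.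

Lemma wf_literal_NoDup (L : literal) : wf_literal L -> NoDup (dom (members L)).
Proof. now intros []. Qed.

(** Induction on the path: a root [This] leads from [L] to [L'], any other root to the same literal
    on both sides. Equality is a separate alternative because the literals of [D] are not assumed
    well formed here. *)
Lemma lookup_with_This (D : declarations) (L L' : literal) :
  extends L L' -> wf_literal L' ->
  forall T K, lookup (with_This D L) T = Some K ->
  exists K', lookup (with_This D L') T = Some K' /\
    (K' = K \/ extends K K' /\ wf_literal K').
Proof.
  intros Hext Hwf; induction T as [C|T IH C]; intros K.
  - simpl; destruct (String.eqb_spec C This) as [->|_]; [|eauto].
    rewrite !subst_literal_This; intros H; injection H as <-; eauto.
  - simpl; destruct (lookup (with_This D L) T) as [K0|]; [|discriminate].
    intros HK; destruct (IH K0 eq_refl) as [K0' [-> [->|[Hext0 Hwf0]]]]; [eauto|].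
    apply lookup_nested_In in HK.
    destruct Hext0 as [b Ts Ms b' Ts' Ms' _ _ Hnested].
    destruct (Hnested C K HK) as [K' [HIn HK']].
    exists K'; split.
    (* [K'] is so far just some member named [C]; distinctness of names makes it the one that lookup
       returns. *)
    + now apply In_lookup_nested; [apply wf_literal_NoDup|].
    + right; split; [exact HK'|exact (wf_literal_nested _ _ _ Hwf0 HIn)].
Qed.

(** One level of [extends] suffices here: nested classes are reached through the longer paths over
    which [T] ranges. *)
Definition lookup_extends (D D' : declarations) : Prop :=
  forall T K, lookup D T = Some K ->
  exists K', lookup D' T = Some K' /\
    incl (implements K) (implements K') /\
    (forall s T0 m ps e, In (Method s T0 m ps e) (members K) ->
       exists e', In (Method s T0 m ps e') (members K')).

Lemma lookup_extends_with_This (D : declarations) (L L' : literal) :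
  extends L L' -> wf_literal L' ->
  lookup_extends (with_This D L) (with_This D L').
Proof.
  intros Hext Hwf T K HK.
  destruct (lookup_with_This D L L' Hext Hwf T K HK) as [K' [HK' Hor]].
  exists K'; split; [exact HK'|].
  destruct Hor as [->|[HKK' _]]; [split; [apply incl_refl|eauto]|].
  now destruct HKK'.
Qed.

(** * Typing is monotone in lookup *)

Lemma subtype_weaken (D D' : declarations) (T1 T2 : type) :
  lookup_extends D D' -> subtype D T1 T2 -> subtype D' T1 T2.
Proof.
  intros HD; induction 1 as [T|T1 T2 T3 L HL HT2 _ IH]; [apply SubRefl|].
  destruct (HD T1 L HL) as [L' [HL' [Hincl _]]].
  eapply SubStep; eauto.
Qed.

Lemma has_type_weaken (D D' : declarations) (G : environment) :
  lookup_extends D D' ->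
  forall e T, has_type D G e T -> has_type D' G e T.
Proof.
  (* Recursion on the typing derivation itself, because the derivations for the arguments are nested
     in [Forall2]. *)
  intros HD; fix IH 3; intros e T H.
  destruct H as [x T Hx|e T1 T2 He Hsub|T0 L T m ps body es HL HM Hes
                |e0 T0 L T m ps body es He0 HL HM Hes].
  - now apply TyVar.
  - eapply TySub; [apply IH, He|now apply (subtype_weaken D)].
  - destruct (HD T0 L HL) as [L' [HL' [_ Hms]]].
    destruct (Hms _ _ _ _ _ HM) as [body' HM'].
    eapply TyStaticCall; [exact HL'|exact HM'|].
    clear HM HM'; induction Hes; constructor; auto.
  - destruct (HD T0 L HL) as [L' [HL' [_ Hms]]].
    destruct (Hms _ _ _ _ _ HM) as [body' HM'].
    eapply TyCall; [apply IH, He0|exact HL'|exact HM'|].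
    clear HM HM'; induction Hes; constructor; auto.
Qed.

Lemma literal_ok_weaken (D D' : declarations) (T : type) (L : literal) :
  lookup_extends D D' ->
  literal_ok D T L -> literal_ok D' T L.
Proof.
  intros HD; revert T L.
  apply (literal_ok_mind D (literal_ok D') (member_ok D'));
    intros; constructor; eauto using has_type_weaken.
Qed.

(** * Sums of well-typed literals *)

Lemma literal_ok_members (D : declarations) (T : type) (L : literal) :
  literal_ok D T L -> forall M, In M (members L) -> member_ok D T M.
Proof. now intros []. Qed.

(** Both summands are checked in the same declarations, so no body has to be retyped. The enclosing
    type [T] is quantified inside each clause because it becomes [TPath T C] for a nested class. *)
Lemma sum_ok (D : declarations) :
  (forall L1 L2 L, literal_sum L1 L2 L -> forall T,
     literal_ok D T L1 -> literal_ok D T L2 -> literal_ok D T L) /\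
  (forall M1 M2 M, member_sum M1 M2 M -> forall T,
     member_ok D T M1 -> member_ok D T M2 -> member_ok D T M) /\
  (forall Ms1 Ms2 Ms, members_sum Ms1 Ms2 Ms -> forall T,
     (forall M, In M Ms1 -> member_ok D T M) ->
     (forall M, In M Ms2 -> member_ok D T M) ->
     forall M, In M Ms -> member_ok D T M).
Proof.
  apply sum_mutind.
  - intros b Ts1 Ts2 Ts Ms1 Ms2 Ms N1 N2 N0 N0' N H1 H2 _ _ _ IH _ HMs T Hok1 Hok2.
    pose proof (literal_ok_members _ _ _ Hok1) as Hok1'; simpl in Hok1'.
    pose proof (literal_ok_members _ _ _ Hok2) as Hok2'; simpl in Hok2'.
    assert (HN1 : forall M, In M (N1 ++ N0) -> member_ok D T M).
    { intros M HM; apply Hok1', (Permutation_in M (Permutation_sym H1) HM). }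
    assert (HN2 : forall M, In M (N2 ++ N0') -> member_ok D T M).
    { intros M HM; apply Hok2', (Permutation_in M (Permutation_sym H2) HM). }
    constructor; intros M HM; apply (Permutation_in M HMs) in HM.
    rewrite !in_app_iff in HM; destruct HM as [HM|[HM|HM]].
    + apply HN1, in_app_iff; now left.
    + apply HN2, in_app_iff; now left.
    + apply (IH T); [| |exact HM]; intros M' HM'.
      * apply HN1, in_app_iff; now right.
      * apply HN2, in_app_iff; now right.
  (* In both method rules the result is literally one of the two summands. *)
  - auto.
  - auto.
  - intros C L1 L2 L _ IH T H1 H2; inversion H1; inversion H2; subst.
    constructor; auto.
  - simpl; tauto.
  - simpl; intros M1 M2 M Ms1 Ms2 Ms _ IHM _ IHMs T H1 H2 M' [<-|HM'];
      [apply IHM|apply (IHMs T)]; auto.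
Qed.

(** Each summand is first moved from its own binding of [This] to the binding of [This] to [L]; then
    [sum_ok] combines them. *)
Lemma well_typed_sum (D : declarations) (L1 L2 L : literal) :
  literal_sum L1 L2 L -> wf_literal L ->
  well_typed D L1 -> well_typed D L2 -> well_typed D L.
Proof.
  intros Hsum Hwf H1 H2.
  destruct (proj1 sum_extends _ _ _ Hsum) as [Hext1 Hext2].
  apply (proj1 (sum_ok _) _ _ _ Hsum).
  - eapply literal_ok_weaken; [|exact H1]; now apply lookup_extends_with_This.
  - eapply literal_ok_weaken; [|exact H2]; now apply lookup_extends_with_This.
Qed.

(** * Counting ill-typed literals *)

(** Passing to the sum changes only the contexts recorded with the occurrences, and the filter looks
    only at the literals. *)
Lemma wrong_sum (D : declarations) (E1 E2 : code) :
  wrong D (CSum E1 E2) = wrong D E1 + wrong D E2.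
Proof.
  unfold wrong; simpl; rewrite filter_app, length_app.
  f_equal; rewrite filter_map_swap, length_map; reflexivity.
Qed.

Lemma wrong_well_typed (D : declarations) (L : literal) :
  well_typed D L -> wrong D (CLit L) = 0.
Proof.
  unfold wrong, ill_typed_b; simpl.
  now destruct (excluded_middle_informative (well_typed D L)).
Qed.

Lemma wrong_ill_typed (D : declarations) (L : literal) :
  ~ well_typed D L -> wrong D (CLit L) = 1.
Proof.
  unfold wrong, ill_typed_b; simpl.
  now destruct (excluded_middle_informative (well_typed D L)).
Qed.

Lemma wrong_le_1 (D : declarations) (L : literal) : wrong D (CLit L) <= 1.
Proof.
  unfold wrong; simpl; destruct (ill_typed_b D L); simpl; lia.
Qed.

Lemma wrong_comp_plug (D : declarations) (X : comp_ctx) (E E' : code) :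
  wrong D E >= wrong D E' ->
  wrong D (comp_plug X E) >= wrong D (comp_plug X E').
Proof. intros H; induction X; simpl; rewrite ?wrong_sum; lia. Qed.

Lemma lookup_trait_In (D : declarations) (t : trait_name) (L : literal) :
  lookup_trait D t = Some L -> In (IdTrait t, L) D.
Proof.
  induction D as [|[[t'|C] L'] D IH]; simpl; [discriminate| |auto].
  destruct (String.eqb_spec t t') as [<-|_]; [|auto].
  intros H; injection H as ->; now left.
Qed.

Theorem theoremA2 (D : declarations) (E0 E1 : code) :
  wf_program D ->
  wf_code D E0 ->
  (forall d, In d D -> declaration_ok D d) ->
  red D E0 E1 ->
  wrong D E0 >= wrong D E1.
Proof.
  intros _ _ HD Hred.
  induction Hred as [t L Ht|L1 L2 L Hsum [Hwf _]|X E E' _ IH].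
  - rewrite (wrong_well_typed D L); [lia|].
    (* For a trait, [declaration_ok] unfolds to [well_typed]. *)
    exact (HD _ (lookup_trait_In _ _ _ Ht)).
  - rewrite wrong_sum.
    destruct (excluded_middle_informative (well_typed D L1)) as [H1|H1];
      [destruct (excluded_middle_informative (well_typed D L2)) as [H2|H2]|].
    + rewrite (wrong_well_typed D L); [lia|].
      exact (well_typed_sum D L1 L2 L Hsum Hwf H1 H2).
    (* An ill-typed summand already contributes 1, the most that the single literal [L] can
       count. *)
    + pose proof (wrong_le_1 D L); rewrite (wrong_ill_typed D L2 H2); lia.
    + pose proof (wrong_le_1 D L); rewrite (wrong_ill_typed D L1 H1); lia.
  - now apply wrong_comp_plug.
Qed.
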